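(* Let $p$ be a prime. There exists a branch $p$-group acting on a regular rooted tree (that is, a branch group $G\le \mathrm{Aut}(\mathcal T)$ with $\mathcal T$ a regular rooted tree, such that $G$ is a $p$-group) that is generated by left Engel elements of order $p$.
   Context: Commutators: $[x,y]=x^{-1}y^{-1}xy$, $[g,_0 h]=g$ and $[g,_{n+1}h]=[[g,_n h],h]$. An element $h$ of a group $G$ is a left Engel element of $G$ if for every $g\in G$ there is $n\in\mathbb N=\{0,1,2,\dots\}$ with $[g,_n h]=\mathrm{id}$. Rooted trees: let $\mathcal X=(X_n)_{n\in\mathbb N}$ be a sequence of finite sets of cardinality at least $2$. The rooted tree $\mathcal T_{\mathcal X}$ has as vertices all finite strings whose $i$-th letter (counting from $0$) lies in $X_i$, including the empty string (the root); two strings are joined by an edge if one is obtained from the other by appending one letter at the end. If all $X_n$ have the same cardinality $q>1$, the tree is called ($q$-)regular. $\mathcal L(n)$ denotes the set of strings of length $n$. $\mathrm{Aut}(\mathcal T_{\mathcal X})$ is the group of root-preserving graph automorphisms, acting on the right, $u\mapsto u.g$. For a string $u$ of length $n$ the section $g|_u\in \mathrm{Aut}(\mathcal T_{(X_m)_{m\ge n}})$ is defined by $(uv).g=(u.g)(v.(g|_u))$. Branch groups: let $G\le\mathrm{Aut}(\mathcal T_{\mathcal X})$. $\mathrm{St}_G(n)$ is the pointwise stabiliser of $\mathcal L(n)$. For $u\in\mathcal L(n)$, the rigid stabiliser of $u$ is $\{g\in \mathrm{St}_G(n): g|_v=\mathrm{id}\text{ for all }v\in\mathcal L(n),\ v\ne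 u\}$, and the $n$-th rigid layer stabiliser $\mathrm{Rist}_G(n)$ is the subgroup generated by the rigid stabilisers of all $u\in\mathcal L(n)$. $G$ is spherically transitive if it acts transitively on every $\mathcal L(n)$, and $G$ is a branch group if it is spherically transitive and $\mathrm{Rist}_G(n)$ has finite index in $G$ for every $n$. *)

(* Defs.v *)
From HB Require Import structures.
From mathcomp Require Import all_boot.
From mathcomp Require Import boolp classical_sets cardinality.

Set Implicit Arguments.
Unset Strict Implicit.
Unset Printing Implicit Defensive.

Local Open Scope classical_set_scope.
Local Open Scope group_scope.

(* [drop_seq n X] is the sequence (X_m)_{m >= n}, reindexed from 0.  The
   identities [drop_seq 0 X = X] and
   [drop_seq n.+1 X = drop_seq n (drop_seq 1 X)] hold by conversion; the
   recursive definitions below typecheck thanks to them. *)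
Definition drop_seq (n : nat) (X : nat -> finType) : nat -> finType :=
  fun m => X (n + m)%N.

(* Finite strings x_0 x_1 ... x_(k-1) with x_i in X_i, head first. *)
Inductive vertex (X : nat -> finType) : Type :=
| Root
| Cons of X 0 & vertex (drop_seq 1 X).

Arguments Root {X}.
Arguments Cons {X} x u.

Fixpoint vlen (X : nat -> finType) (u : vertex X) : nat :=
  if u is Cons _ u' then (vlen u').+1 else 0.

(* [vcat n u v] is the concatenation uv for u of length n (when u is shorter
   than n the value is meaningless). *)
Fixpoint vcat (X : nat -> finType) (n : nat) :
    vertex X -> vertex (drop_seq n X) -> vertex X :=
  match n return vertex X -> vertex (drop_seq n X) -> vertex X with
  | 0 => fun _ v => v
  | n'.+1 => fun u v => if u is Cons x u' then Cons x (@vcat _ n' u' v) else Root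
  end.

(* [vdrop n u] removes the first n letters of u. *)
Fixpoint vdrop (X : nat -> finType) (n : nat) :
    vertex X -> vertex (drop_seq n X) :=
  match n return vertex X -> vertex (drop_seq n X) with
  | 0 => fun u => u
  | n'.+1 => fun u => if u is Cons _ u' then @vdrop _ n' u' else Root
  end.

Definition one_letter (X : nat -> finType) (x : X 0) : vertex X := Cons x Root.

(* [drop_seq (vlen u) X 0] is the alphabet X_k with k = vlen u: v is u with one
   letter appended at the end. *)
Definition child (X : nat -> finType) (u v : vertex X) : Prop :=
  exists x : drop_seq (vlen u) X 0, v = vcat u (one_letter x).

Definition adj (X : nat -> finType) (u v : vertex X) : Prop :=
  child u v \/ child v u.

(* The inverse is a field of the record, but it is determined by [aut_fun];
   see [autP]. *)
Record aut (X : nat -> finType) := Aut {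
  aut_fun :> vertex X -> vertex X;
  aut_inv : vertex X -> vertex X;
  aut_funK : cancel aut_fun aut_inv;
  aut_invK : cancel aut_inv aut_fun;
  aut_root : aut_fun Root = Root;
  aut_adj : forall u v, adj (aut_fun u) (aut_fun v) <-> adj u v
}.

Lemma autP (X : nat -> finType) (g h : aut X) : g =1 h -> g = h.
Proof.
case: g h => [f f' fK f'K f0 fa] [k k' kK k'K k0 ka] /= /funext E.
subst k.
have E' : f' = k' by apply: funext => u; rewrite -{1}(k'K u) fK.
subst k'; congr Aut; exact: Prop_irrelevance.
Qed.

Definition aut_id (X : nat -> finType) : aut X.
Proof. by apply: (@Aut X id id). Defined.

Definition aut_mul (X : nat -> finType) (g h : aut X) : aut X.
Proof.
apply: (@Aut X (h \o g) (aut_inv g \o aut_inv h)) => [u|u||u v] /=.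
- by rewrite !aut_funK.
- by rewrite !aut_invK.
- by rewrite !aut_root.
- by rewrite !aut_adj.
Defined.

Definition aut_invg (X : nat -> finType) (g : aut X) : aut X.
Proof.
apply: (@Aut X (aut_inv g) g) => [||| u v].
- exact: aut_invK.
- exact: aut_funK.
- by rewrite -{1}(aut_root g) aut_funK.
- by rewrite -(aut_adj g) !aut_invK.
Defined.

Lemma aut_mulA (X : nat -> finType) : associative (@aut_mul X).
Proof. by move=> f g h; apply: autP. Qed.
Lemma aut_mul1 (X : nat -> finType) : left_id (@aut_id X) (@aut_mul X).
Proof. by move=> f; apply: autP. Qed.
Lemma aut_mulr1 (X : nat -> finType) : right_id (@aut_id X) (@aut_mul X).
Proof. by move=> f; apply: autP. Qed.
Lemma aut_mulV (X : nat -> finType) :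
  left_inverse (@aut_id X) (@aut_invg X) (@aut_mul X).
Proof. by move=> f; apply: autP => u /=; rewrite aut_invK. Qed.
Lemma aut_mulVr (X : nat -> finType) :
  right_inverse (@aut_id X) (@aut_invg X) (@aut_mul X).
Proof. by move=> f; apply: autP => u /=; rewrite aut_funK. Qed.

HB.instance Definition _ (X : nat -> finType) := gen_eqMixin (aut X).
HB.instance Definition _ (X : nat -> finType) := gen_choiceMixin (aut X).
(* Automorphisms act on the right: u.(gh) = (u.g).h. *)
HB.instance Definition _ (X : nat -> finType) :=
  isGroup.Build (aut X) (@aut_mulA X) (@aut_mul1 X) (@aut_mulr1 X)
    (@aut_mulV X) (@aut_mulVr X).

Lemma aut_mulE (X : nat -> finType) (g h : aut X) u : (g * h) u = h (g u).
Proof. by []. Qed.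

Fixpoint vtake (X : nat -> finType) (n : nat) (u : vertex X) : vertex X :=
  match n, u with
  | n'.+1, Cons x u' => Cons x (vtake n' u')
  | _, _ => Root
  end.

Lemma vlen_vtake X n (u : vertex X) : (n <= vlen u)%N -> vlen (vtake n u) = n.
Proof.
elim: n X u => [|n IH] X [|x u] //= h; congr S; exact: IH.
Qed.

Lemma vtake_oversize X n (u : vertex X) : (vlen u <= n)%N -> vtake n u = u.
Proof.
elim: n X u => [|n IH] X [|x u] //= h; congr Cons; exact: IH.
Qed.

Lemma vtake_vtake X m n (u : vertex X) :
  (m <= n)%N -> vtake m (vtake n u) = vtake m u.
Proof.
elim: m n X u => [|m IH] [|n] X [|x u] //= h; congr Cons; exact: IH.
Qed.

Lemma vlen_vcat X n (u : vertex X) (v : vertex (drop_seq n X)) :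
  vlen u = n -> vlen (vcat u v) = (n + vlen v)%N.
Proof.
elim: n X u v => [|n IH] X [|x u] v //= [h]; by rewrite (IH _ u v h).
Qed.

Lemma vtake_vcat X n (u : vertex X) (v : vertex (drop_seq n X)) :
  vlen u = n -> vtake n (vcat u v) = u.
Proof.
elim: n X u v => [|n IH] X [|x u] v //= [h]; by rewrite (IH _ u v h).
Qed.

Lemma vdrop_vcat X n (u : vertex X) (v : vertex (drop_seq n X)) :
  vlen u = n -> vdrop n (vcat u v) = v.
Proof.
elim: n X u v => [|n IH] X [|x u] v //= [h]; exact: (IH _ u v h).
Qed.

Lemma vcat_vdrop X n (z : vertex X) :
  (n <= vlen z)%N -> vcat (vtake n z) (vdrop n z) = z.
Proof.
elim: n X z => [|n IH] X [|x z] //= h; by rewrite IH.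
Qed.

Lemma vlen_vdrop X n (z : vertex X) : vlen (vdrop n z) = (vlen z - n)%N.
Proof. elim: n X z => [|n IH] X [|x z] //=; exact: IH. Qed.

Lemma childP X (u v : vertex X) :
  child u v <-> vlen v = (vlen u).+1 /\ vtake (vlen u) v = u.
Proof.
split=> [[x ->]|[lv tv]].
  by rewrite vlen_vcat // vtake_vcat // addn1.
have le : (vlen u <= vlen v)%N by rewrite lv.
have ld : vlen (vdrop (vlen u) v) = 1%N by rewrite vlen_vdrop lv subSnn.
have := vcat_vdrop le; rewrite tv.
case: (vdrop _ v) ld => [|x [|y w]] //= _ <-.
by exists x.
Qed.

Lemma child_vtake X n (u : vertex X) :
  (n < vlen u)%N -> child (vtake n u) (vtake n.+1 u).
Proof.
move=> h; apply/childP; rewrite !vlen_vtake ?(ltnW h) //; split=> //.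
exact: vtake_vtake.
Qed.

Lemma vlen0 X (u : vertex X) : vlen u = 0 -> u = Root.
Proof. by case: u. Qed.

Lemma adj_vlen X (u v : vertex X) :
  adj u v -> vlen v = (vlen u).+1 \/ vlen u = (vlen v).+1.
Proof. by case=> /childP[-> _]; [left|right]. Qed.

Lemma aut_vlen X (g : aut X) (u : vertex X) : vlen (g u) = vlen u.
Proof.
move: {2}(vlen u) (leqnn (vlen u)) => n.
elim: n g u => [|n IH] g u le.
  by move: le; rewrite leqn0 => /eqP/vlen0->; rewrite aut_root.
move: le; rewrite leq_eqVlt => /orP[/eqP lu|]; last by rewrite ltnS; exact: IH.
have /(child_vtake (n := n)) : (n < vlen u)%N by rewrite lu.
rewrite [vtake n.+1 u]vtake_oversize ?lu // => cu.
have lt : vlen (vtake n u) = n by rewrite vlen_vtake // lu.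
have : adj (g (vtake n u)) (g u) by apply/aut_adj; left.
case/adj_vlen; rewrite (IH g (vtake n u)) lt ?leqnn // => E.
have le : (vlen (g u) <= n)%N by rewrite E leqnSn.
have := IH g^-1 _ le.
have -> : g^-1 (g u) = u by exact: aut_funK.
by move=> E2; move: le; rewrite -E2 lu ltnn.
Qed.

Lemma aut_vtake X (g : aut X) n (u : vertex X) : g (vtake n u) = vtake n (g u).
Proof.
have [le|lt] := leqP (vlen u) n.
  by rewrite !vtake_oversize ?aut_vlen.
move: {2}(vlen u - n)%N (erefl (vlen u - n)%N) => d.
elim: d n lt => [|d IH] n lt E.
  by move/eqP: E; rewrite subn_eq0 leqNgt lt.
have E1 : g (vtake n.+1 u) = vtake n.+1 (g u).
  move: (lt); rewrite leq_eqVlt => /orP[/eqP e|lt1].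
    by rewrite !vtake_oversize ?aut_vlen ?e.
  by apply: IH => //; rewrite subnS E.
have : adj (g (vtake n u)) (g (vtake n.+1 u)).
  by apply/aut_adj; left; exact: child_vtake.
have l0 : vlen (vtake n u) = n by rewrite vlen_vtake // ltnW.
have l1 : vlen (vtake n.+1 u) = n.+1 by rewrite vlen_vtake.
case=> /childP; rewrite !aut_vlen l0 l1.
  by case=> _ <-; rewrite E1 vtake_vtake.
by case=> /eqP; rewrite ltn_eqF // ltnW.
Qed.

Definition level (X : nat -> finType) (n : nat) := {u : vertex X | vlen u == n}.

Lemma vlen_level X n (u : level X n) : vlen (val u) = n.
Proof. exact/eqP/(valP u). Qed.

Lemma act_proof X (g : aut X) n (u : level X n) : vlen (g (val u)) == n.
Proof. by rewrite aut_vlen (valP u). Qed.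

(* u.g for u in L(n). *)
Definition act (X : nat -> finType) (n : nat) (u : level X n) (g : aut X) :
  level X n := exist _ (g (val u)) (act_proof g u).

(* v.(g|_u) is obtained by deleting the prefix u.g from (uv).g. *)
Definition section_fun (X : nat -> finType) (n : nat) (g : aut X)
    (u : level X n) (v : vertex (drop_seq n X)) : vertex (drop_seq n X) :=
  vdrop n (g (vcat (val u) v)).

Lemma section_funE X n (g : aut X) (u : level X n) v :
  g (vcat (val u) v) = vcat (val (act u g)) (section_fun g u v).
Proof.
rewrite /section_fun -{1}[LHS](@vcat_vdrop _ n).
  by rewrite -aut_vtake vtake_vcat // vlen_level.
by rewrite aut_vlen vlen_vcat ?vlen_level // leq_addr.
Qed.

Lemma child_vcat X n (u : vertex X) (v w : vertex (drop_seq n X)) :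
  vlen u = n -> child (vcat u v) (vcat u w) <-> child v w.
Proof.
move=> lu; rewrite !childP !vlen_vcat // -addnS.
have -> : vtake (n + vlen v) (vcat u w) = vcat u (vtake (vlen v) w).
  elim: n X u v w lu => [|n IH] X [|x u] v w //= [lu].
  by congr Cons; exact: IH.
split=> [[/addnI-> E]|[-> ->]] //; split=> //.
by rewrite -(vdrop_vcat (vtake (vlen v) w) lu) E vdrop_vcat.
Qed.

Lemma adj_vcat X n (u : vertex X) (v w : vertex (drop_seq n X)) :
  vlen u = n -> adj (vcat u v) (vcat u w) <-> adj v w.
Proof. by move=> lu; rewrite /adj !child_vcat. Qed.

Lemma section_funK X n (g : aut X) (u : level X n) :
  cancel (section_fun g u) (section_fun g^-1 (act u g)).
Proof.
move=> v; rewrite {1}/section_fun -section_funE.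
have -> : g^-1 (g (vcat (val u) v)) = vcat (val u) v by exact: aut_funK.
by rewrite vdrop_vcat // vlen_level.
Qed.

Lemma actK X n (g : aut X) (u : level X n) : act (act u g) g^-1 = u.
Proof. by apply: val_inj; exact: aut_funK. Qed.

Definition section (X : nat -> finType) (n : nat) (g : aut X) (u : level X n) :
  aut (drop_seq n X).
Proof.
apply: (@Aut _ (section_fun g u) (section_fun g^-1 (act u g))) => [||| v w].
- exact: section_funK.
- move=> v; have := section_funK g^-1 (act u g) v.
  by rewrite actK invgK.
- apply: vlen0; rewrite vlen_vdrop aut_vlen vlen_vcat ?vlen_level //.
  by rewrite addn0 subnn.
- rewrite -(adj_vcat _ _ (vlen_level (act u g))) -!section_funE aut_adj.
  by rewrite adj_vcat ?vlen_level.
Defined.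

(* (uv).g = (u.g)(v.(g|_u)) *)
Lemma sectionE X n (g : aut X) (u : level X n) (v : vertex (drop_seq n X)) :
  g (vcat (val u) v) = vcat (val (act u g)) (section g u v).
Proof. exact: section_funE. Qed.

Definition regular (X : nat -> finType) : Prop :=
  exists2 q : nat, (1 < q)%N & forall n, #|X n| = q.

Section GroupNotions.
Variable T : groupType.
Implicit Types (G H S : set T) (g h : T).

Definition is_subgroup G : Prop :=
  [/\ G 1, (forall g h, G g -> G h -> G (g * h)) & (forall g, G g -> G g^-1)].

Definition generated S : set T := smallest is_subgroup S.

Definition rcoset_of H g : set T := [set h * g | h in H].

Definition finite_index H G : Prop :=
  H `<=` G /\ finite_set [set rcoset_of H g | g in G].

Definition has_order g (n : nat) : Prop :=
  [/\ (0 < n)%N, g ^+ n = 1 & forall m, (0 < m < n)%N -> g ^+ m <> 1].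

Definition is_p_group (p : nat) G : Prop :=
  forall g, G g -> exists k, has_order g (p ^ k)%N.

(* [g,_n h]; here [~ x, y] unfolds to x^-1 * (y^-1 * (x * y)). *)
Definition engel_comm g h (n : nat) : T := iter n (fun x => [~ x, h]) g.

Definition left_engel G h : Prop :=
  G h /\ forall g, G g -> exists n, engel_comm g h n = 1.

End GroupNotions.

Section Branch.
Variables (X : nat -> finType) (G : set (aut X)).

Definition level_stab (n : nat) : set (aut X) :=
  [set g | G g /\ forall u : level X n, act u g = u].

Definition rigid_stab (n : nat) (u : level X n) : set (aut X) :=
  [set g | level_stab n g /\
           forall v : level X n, v <> u -> section g v = 1].

Definition rigid_level_stab (n : nat) : set (aut X) :=
  generated (\bigcup_(u : level X n) rigid_stab u).

Definition spherically_transitive : Prop :=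
  forall n (u v : level X n), exists2 g, G g & act u g = v.

Definition branch_group : Prop :=
  [/\ is_subgroup G, spherically_transitive
    & forall n, finite_index (rigid_level_stab n) G].

End Branch.

(* Main.v *)
(** The group is the finitary group of the p-regular tree: the union over n of
    the iterated wreath products [C_p wr ... wr C_p] acting on the first n
    levels.  It is locally a finite p-group, it is transitive on every level
    because each of these wreath products is, and modulo its n-th rigid layer
    stabiliser it is represented by the finite group of depth n.  It is
    generated by the rotations, which permute cyclically the children of one
    vertex.  The rotation h at the root is left Engel: [g,h] fixes the first
    level, and on such elements commutation with h replaces the tuple of
    sections [w] by [x |-> w_x^-1 w_(x-1)].  On the labels of each level, with
    values in F_p, this is the operator T - 1 for a cyclic translation T, and
    [(T - 1)^p = T^p - 1 = 0], so p further commutators kill one more level.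
    A rotation below the root is treated letter by letter. *)
Require Import Defs.
From mathcomp Require Import all_boot perm all_algebra.
From mathcomp Require Import boolp classical_sets cardinality.

Set Implicit Arguments.
Unset Strict Implicit.
Unset Printing Implicit Defensive.

Import GRing.Theory.
Local Open Scope classical_set_scope.
Local Open Scope group_scope.

(** * Generated subgroups, orders of elements, iterated commutators *)

Section GeneratedSubgroups.
Variable T : groupType.
Implicit Types (A H : set T) (g h : T).

Lemma generated_subgroup A : is_subgroup (generated A).
Proof.
split=> [H [[]] //|g h Ag Ah H HA|g Ag H HA].
- by case: (HA) => -[_ M _] _; apply: M; [apply: Ag | apply: Ah].
- by case: (HA) => -[_ _ V] _; apply: V; apply: Ag.
Qed.

Lemma sub_generated A : A `<=` generated A.
Proof. by move=> g Ag H [_]; apply. Qed.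

Lemma generated_min A H : is_subgroup H -> A `<=` H -> generated A `<=` H.
Proof. by move=> sH AH g; apply. Qed.

Lemma has_order_p_power p n g :
  prime p -> g ^+ (p ^ n) = 1 -> exists k, has_order g (p ^ k)%N.
Proof.
move=> pp gn.
have ex : exists m, (0 < m)%N && (g ^+ m == 1).
  by exists (p ^ n)%N; rewrite expn_gt0 prime_gt0 // gn eqxx.
case: (ex_minnP ex) => m /andP[m0 /eqP gm] min.
have : (m %| p ^ n)%N.
  rewrite /dvdn; case: posnP => // r0.
  have /min : (0 < p ^ n %% m)%N && (g ^+ (p ^ n %% m) == 1).
    rewrite r0; move: gn; rewrite {1}(divn_eq (p ^ n) m) expgnDr mulnC.
    by rewrite expgnA gm expg1n mul1g => ->; rewrite eqxx.
  by rewrite leqNgt ltn_mod m0.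
case/dvdn_pfactor => // k _ E; exists k; rewrite -E; split=> // j /andP[j0 jm].
move/eqP=> gj; have := min j; rewrite j0 gj => /(_ isT).
by rewrite leqNgt jm.
Qed.

Lemma engel_comm1 h n : engel_comm 1 h n = 1.
Proof.
by rewrite /engel_comm; elim: n => //= n ->; rewrite comm1g.
Qed.

Lemma engel_commS g h n : engel_comm g h n.+1 = engel_comm [~ g, h] h n.
Proof. by rewrite /engel_comm iterSr. Qed.

Lemma engel_comm_le g h m n :
  (m <= n)%N -> engel_comm g h m = 1 -> engel_comm g h n = 1.
Proof.
by move=> /subnK <-; rewrite /engel_comm iterD => ->; exact: engel_comm1.
Qed.

End GeneratedSubgroups.

(** Commutator lengths are found letter by letter; since the alphabet is finite, the maximum serves
    all letters at once. *)
Lemma uniform_bound (I : finType) (P : I -> nat -> Prop) :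
  (forall i m n, (m <= n)%N -> P i m -> P i n) ->
  (forall i, exists n, P i n) -> exists n, forall i, P i n.
Proof.
move=> mono /choice[f fP]; exists (\max_i f i) => i.
exact: mono (leq_bigmax i) (fP i).
Qed.

(* With [T] the translation operator [f |-> f (_ - 1)], the Frobenius identity
   in the ring of operators reads [(T - 1)^p = T^p - 1 = 0]. *)
Lemma iter_difference_eq0 p (f : 'F_p -> 'F_p) : prime p ->
  iter p (fun (h : 'F_p -> 'F_p) x => h (x - 1)%R - h x)%R f = fun=> 0%R.
Proof.
move=> pp; set Delta := (fun (h : 'F_p -> 'F_p) => _).
have sub1_inj : injective (fun x : 'F_p => x - 1)%R by exact: addIr.
(* ['F_p] unfolds to the ordinals below this size, so its elements index matrix rows directly and
   functions on ['F_p] become column vectors. *)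
pose T := perm_mx (perm sub1_inj) : 'M['F_p]_((Zp_trunc (pdiv p)).+2).
pose c (h : 'F_p -> 'F_p) : 'cV['F_p]_((Zp_trunc (pdiv p)).+2) := (\col_i h i)%R.
have TE v x : (T *m v)%R x ord0 = v (x - 1)%R ord0 :> 'F_p.
  by rewrite -row_permE mxE permE.
have TnE n v x : (T ^+ n *m v)%R x ord0 = v (x - n%:R)%R ord0 :> 'F_p.
  elim: n v x => [|n IH] v x; first by rewrite expr0 mul1mx subr0.
  by rewrite exprSr -mulmxA IH TE -addrA -opprD -natr1.
have cD n : c (iter n Delta f) = ((T - 1) ^+ n *m c f)%R.
  elim: n => [|n IH]; first by rewrite expr0 mul1mx.
  rewrite iterS exprS -mulmxA -IH mulmxBl mul1mx; apply/matrixP => x j.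
  by rewrite (ord1 j) mxE [RHS]mxE TE !mxE.
(* The matrix ring inherits characteristic [p] from its entries, which makes the Frobenius identity
   available for the commuting pair [T], 1. *)
have chM : p \in [pchar 'M['F_p]_((Zp_trunc (pdiv p)).+2)]%R.
  apply/andP; split=> //; apply/eqP/matrixP => i j.
  by rewrite mulmxnE -mulr_natr pchar_Fp_0 // mulr0 mxE.
apply/funext => x; have /matrixP/(_ x ord0) := cD p; rewrite mxE => ->.
have := pFrobenius_autB_comm chM (commr1 T).
rewrite !pFrobenius_autE expr1n => ->.
by rewrite mulmxBl mul1mx mxE TnE !mxE pchar_Fp_0 // subr0 subrr.
Qed.

(** * Wreath recursion on the p-regular tree *)

(** For this constant sequence, [drop_seq n] is convertible to the identity: sections have the same
    type as elements, so the wreath recursion can be iterated. *)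
Definition Fp_alphabet (p : nat) : nat -> finType := fun _ => 'F_p.

Definition wreath_fun p (k : 'F_p) (w : 'F_p -> aut (Fp_alphabet p))
    (u : vertex (Fp_alphabet p)) : vertex (Fp_alphabet p) :=
  if u is Defs.Cons x u' then @Defs.Cons (Fp_alphabet p) (x + k)%R (w x u')
  else Root.

Definition wreath_inv p (k : 'F_p) (w : 'F_p -> aut (Fp_alphabet p))
    (u : vertex (Fp_alphabet p)) : vertex (Fp_alphabet p) :=
  if u is Defs.Cons x u' then
    @Defs.Cons (Fp_alphabet p) (x - k)%R ((w (x - k)%R)^-1 u')
  else Root.

Lemma wreath_funK p k w : cancel (@wreath_fun p k w) (wreath_inv k w).
Proof. by case=> //= x u; rewrite addrK aut_funK. Qed.

Lemma wreath_invK p k w : cancel (wreath_inv k w) (@wreath_fun p k w).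
Proof. by case=> //= x u; rewrite addrNK aut_invK. Qed.

(** By [childP], being a child depends only on length and truncation; the wreath recursion preserves
    the former and commutes with the latter. *)
Lemma child_wreath_fun p k w (u v : vertex (Fp_alphabet p)) :
  child (wreath_fun k w u) (wreath_fun k w v) <-> child u v.
Proof.
have len t : vlen (wreath_fun k w t) = vlen t.
  by case: t => //= x t; rewrite aut_vlen.
have take n t : wreath_fun k w (vtake n t) = vtake n (wreath_fun k w t).
  by case: n t => [|n] [|x t] //=; rewrite aut_vtake.
rewrite !childP !len -take; split=> -[-> E]; split=> //; last by rewrite E.
exact: can_inj (@wreath_funK p k w) _ _ E.
Qed.

Definition wreath p (k : 'F_p) (w : 'F_p -> aut (Fp_alphabet p)) :
  aut (Fp_alphabet p).
Proof.
apply: (Aut (@wreath_funK p k w) (@wreath_invK p k w)) => // u v.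
by rewrite /adj !child_wreath_fun.
Defined.

Section Wreath.
Variable p : nat.
Local Notation A := (Fp_alphabet p).
Implicit Types (k l : 'F_p) (w v : 'F_p -> aut A) (g h : aut A).

Lemma wreath1 : wreath 0%R (fun=> 1) = 1 :> aut A.
Proof. by apply: autP => -[|x u] //=; rewrite addr0. Qed.

Lemma wreathM k l w v :
  wreath k w * wreath l v = wreath (k + l)%R (fun x => w x * v (x + k)%R).
Proof. by apply: autP => -[|x u] //=; rewrite addrA. Qed.

Lemma wreathV k w : (wreath k w)^-1 = wreath (- k)%R (fun x => (w (x - k)%R)^-1).
Proof. by apply: autP => -[|x u]. Qed.

Lemma wreath0M w v :
  wreath 0%R w * wreath 0%R v = wreath 0%R (fun x => w x * v x).
Proof.
by rewrite wreathM addr0; congr wreath; apply/funext => x; rewrite addr0.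
Qed.

Lemma wreath0V w : (wreath 0%R w)^-1 = wreath 0%R (fun x => (w x)^-1).
Proof.
by rewrite wreathV oppr0; congr wreath; apply/funext => x; rewrite addr0.
Qed.

Lemma wreath0R w v :
  [~ wreath 0%R w, wreath 0%R v] = wreath 0%R (fun x => [~ w x, v x]).
Proof. by rewrite /commg /conjg !wreath0V !wreath0M. Qed.

Lemma wreath0X w n : wreath 0%R w ^+ n = wreath 0%R (fun x => w x ^+ n).
Proof.
elim: n => [|n IH]; first by rewrite expg0 -wreath1.
by rewrite expgS IH wreath0M; congr wreath; apply/funext => x; rewrite expgS.
Qed.

Lemma wreath_inj k l w v : wreath k w = wreath l v -> k = l /\ w = v.
Proof.
move=> E; have Ex x u := congr1 (fun g : aut A => g (@Defs.Cons A x u)) E.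
split.
  have /(congr1 (fun t => if t is Defs.Cons y _ then y else 0%R)) := Ex 0%R Root.
  exact: addrI.
by apply/funext => x; apply: autP => u; case: (Ex x u).
Qed.

Definition at_letter (i : 'F_p) g : aut A :=
  wreath 0%R (fun x => if x == i then g else 1).

Lemma at_letterM i g h : at_letter i (g * h) = at_letter i g * at_letter i h.
Proof.
rewrite wreath0M; congr wreath; apply/funext => x.
by case: ifP => // _; rewrite mulg1.
Qed.

Lemma at_letter1 i : at_letter i 1 = 1.
Proof. by rewrite -[RHS]wreath1; congr wreath; apply/funext => x; case: ifP. Qed.

Lemma at_letterV i g : at_letter i g^-1 = (at_letter i g)^-1.
Proof.
rewrite wreath0V; congr wreath; apply/funext => x.
by case: ifP => // _; rewrite invg1.
Qed.

Lemma at_letterX i g n : at_letter i (g ^+ n) = at_letter i g ^+ n.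
Proof.
by elim: n => [|n IH]; rewrite ?expg0 ?at_letter1 // !expgS at_letterM IH.
Qed.

Lemma at_letter_inj i : injective (at_letter i).
Proof.
move=> g h /wreath_inj[_ /(congr1 (fun w => w i))].
by rewrite eqxx.
Qed.

(** Since [at_letter i] is a homomorphism, the preimage of [H] is a subgroup, and only generators
    have to be tested. *)
Lemma at_letter_generated (S : set (aut A)) (H : set (aut A)) i :
  is_subgroup H -> (forall s, S s -> H (at_letter i s)) ->
  forall g, generated S g -> H (at_letter i g).
Proof.
move=> [H1 HM HV] SH g; apply: (@generated_min _ S [set s | H (at_letter i s)]) => //.
split=> /=; first by rewrite at_letter1.
  by move=> a b Ha Hb; rewrite at_letterM; exact: HM.
by move=> a Ha; rewrite at_letterV; exact: HV.
Qed.

Lemma wreath0_subgroup (H : set (aut A)) w :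
  is_subgroup H -> (forall i, H (at_letter i (w i))) -> H (wreath 0%R w).
Proof.
move=> [H1 HM _] Hw.
(* The tuple is the product of its components, multiplied in one letter at a time along a list; a
   repeated letter changes nothing. *)
suff Hs (s : seq 'F_p) : H (wreath 0%R (fun x => if x \in s then w x else 1)).
  have := Hs (enum 'F_p); congr (H (wreath _ _)).
  by apply/funext => x; rewrite mem_enum.
elim: s => [|i s IH]; first by rewrite wreath1.
have [si|si] := boolP (i \in s).
  move: IH; congr (H (wreath _ _)); apply/funext => x.
  by rewrite inE; case: eqP => // ->; rewrite si.
have := HM _ _ (Hw i) IH; rewrite wreath0M; congr (H (wreath _ _)).
apply/funext => x; rewrite inE; case: eqP => [->|_] /=; last by rewrite mul1g.
by rewrite (negbTE si) mulg1.
Qed.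

End Wreath.

(** * The finitary group *)

(** The [n]-fold iterated wreath product of the additive group of ['F_p]. *)
Fixpoint finitary_depth p (n : nat) : set (aut (Fp_alphabet p)) :=
  if n is m.+1 then
    [set g | exists k w, g = wreath k w /\ forall x, finitary_depth m (w x)]
  else [set 1].

Definition finitary p : set (aut (Fp_alphabet p)) :=
  \bigcup_n finitary_depth n.

Definition rotation p : aut (Fp_alphabet p) := wreath 1%R (fun=> 1).

Fixpoint rotations_at p (n : nat) : set (aut (Fp_alphabet p)) :=
  if n is m.+1 then [set at_letter i.1 i.2 | i in setT `*` rotations_at m]
  else [set rotation p].

Arguments finitary_depth p n : clear implicits.
Arguments finitary p : clear implicits.
Arguments rotations_at p n : clear implicits.

Section Finitary.
Variable p : nat.
Hypothesis pp : prime p.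
Local Notation A := (Fp_alphabet p).
Local Notation D n := (finitary_depth p n).
Implicit Types (k l : 'F_p) (w v : 'F_p -> aut A) (g h : aut A).

Lemma wreath_finitary_depth n k w :
  (forall x, D n (w x)) -> D n.+1 (wreath k w).
Proof. by move=> Dw; exists k, w. Qed.

Lemma finitary_depth_subgroup n : is_subgroup (D n).
Proof.
elim: n => [|n [H1 HM HV]] /=.
  by split=> // [g h /= -> ->|g /= ->]; rewrite ?mulg1 ?invg1.
split=> [|_ _ [k [w [-> Hw]]] [l [v [-> Hv]]]|_ [k [w [-> Hw]]]].
- by rewrite -wreath1; exact: wreath_finitary_depth.
- by rewrite wreathM; apply: wreath_finitary_depth => x; exact: HM.
- by rewrite wreathV; apply: wreath_finitary_depth => x; exact: HV.
Qed.

Lemma finitary_depth1 n : D n 1.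
Proof. by have [] := finitary_depth_subgroup n. Qed.

Lemma finitary_depthM n g h : D n g -> D n h -> D n (g * h).
Proof. by have [_ M _] := finitary_depth_subgroup n; exact: M. Qed.

Lemma finitary_depthV n g : D n g -> D n g^-1.
Proof. by have [_ _ V] := finitary_depth_subgroup n; exact: V. Qed.

Lemma finitary_depthS n g : D n g -> D n.+1 g.
Proof.
elim: n g => [|n IH] g /=.
  by move=> ->; exact: (finitary_depth1 1).
move=> [k [w [-> Hw]]]; apply: (@wreath_finitary_depth n.+1) => x.
exact: IH.
Qed.

Lemma finitary_depth_le m n g : (m <= n)%N -> D m g -> D n g.
Proof.
move=> /subnK <-; elim: (n - m)%N => // d IH Dg.
by rewrite addSn; apply: finitary_depthS; exact: IH.
Qed.

Lemma finitary_subgroup : is_subgroup (finitary p).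
Proof.
split=> [|g h [m _ Dg] [n _ Dh]|g [n _ Dg]]; first by exists 0.
  exists (maxn m n) => //; apply: finitary_depthM.
    by apply: finitary_depth_le Dg; exact: leq_maxl.
  by apply: finitary_depth_le Dh; exact: leq_maxr.
by exists n => //; exact: finitary_depthV.
Qed.

Lemma at_letter_finitary i g : finitary p g -> finitary p (at_letter i g).
Proof.
move=> [n _ Dg]; exists n.+1 => //; apply: wreath_finitary_depth => x.
by case: ifP => // _; exact: finitary_depth1.
Qed.

(** * Exponent of the finitary group and transitivity on levels *)

Lemma wreathX k w n : (forall x, D n (w x)) -> forall m, exists2 v,
  wreath k w ^+ m = wreath (k *+ m)%R v & forall x, D n (v x).
Proof.
move=> Dw; elim=> [|m [v E Dv]].
  exists (fun=> 1); first by rewrite expg0 mulr0n wreath1.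
  by move=> x; exact: finitary_depth1.
exists (fun x => w x * v (x + k)%R); first by rewrite expgS E wreathM mulrS.
by move=> x; exact: finitary_depthM.
Qed.

Lemma finitary_depth_exponent n g : D n g -> g ^+ (p ^ n) = 1.
Proof.
elim: n g => [|n IH] g /=; first by move=> ->; rewrite expg1n.
move=> [k [w [-> Dw]]]; rewrite expnS expgnA.
have [v ->] := wreathX k Dw p.
(* The [p]-th power has root label [p k = 0], so it is a tuple of elements of depth [n], on which
   powers are taken coordinatewise. *)
rewrite -mulr_natr pchar_Fp_0 // mulr0 => Dv; rewrite wreath0X -wreath1.
by congr wreath; apply/funext => x; exact: IH.
Qed.

Lemma finitary_p_group : is_p_group p (finitary p).
Proof.
by move=> g [n _ /finitary_depth_exponent]; exact: has_order_p_power.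
Qed.

Lemma finitary_spherically_transitive : spherically_transitive (finitary p).
Proof.
suff H n (u v : vertex A) :
    vlen u = n -> vlen v = n -> exists2 g, D n g & g u = v.
  move=> n u v.
  have [g Dg E] := H n (val u) (val v) (vlen_level u) (vlen_level v).
  by exists g; [exists n | exact: val_inj].
elim: n u v => [|n IH] [|x u] [|y v] //= => [_ _|[lu] [lv]]; first by exists 1.
have [g Dg E] := IH u v lu lv.
(* The label moves [x] to [y]; only the section at [x] matters, so it is repeated at every
   letter. *)
exists (wreath (y - x)%R (fun=> g)); first exact: wreath_finitary_depth.
by rewrite /= E addrC subrK.
Qed.

(** * Rotations: generation and order *)

Lemma rotationX m : rotation p ^+ m = wreath m%:R%R (fun=> 1).
Proof.
elim: m => [|m IH]; first by rewrite expg0 wreath1.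
rewrite expgSr IH wreathM -natr1; congr wreath; apply/funext => x.
by rewrite mulg1.
Qed.

Lemma generated_rotations :
  generated (\bigcup_n rotations_at p n) = finitary p.
Proof.
set S := \bigcup_n _; apply/seteqP; split.
  apply: generated_min => [|h [n _]]; first exact: finitary_subgroup.
  elim: n h => [|n IH] h /=.
    move=> ->; exists 1%N => //; exact: (@wreath_finitary_depth 0).
  by move=> [[i s] [_ /IH] Hs <-]; exact: at_letter_finitary.
have sub := generated_subgroup S; have [S1 SM _] := sub.
(* [at_letter i] sends rotations at level [n] to rotations at level [n.+1], hence preserves the
   subgroup they generate. *)
have at_S i g : generated S g -> generated S (at_letter i g).
  apply: at_letter_generated => // s [n _ Ss]; apply: sub_generated.
  by exists n.+1 => //; exists (i, s).
move=> g [n _]; elim: n g => [|n IH] g /=; first by move=> ->.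
move=> [k [w [-> Dw]]].
(* The root label is split off as a power of the rotation; the other factor fixes the first level
   and falls to the induction. *)
have -> : wreath k w = wreath 0%R w * rotation p ^+ k.
  rewrite rotationX wreathM add0r natr_Zp; congr wreath; apply/funext => x.
  by rewrite mulg1.
apply: (SM); first by apply: wreath0_subgroup => // i; apply: at_S; exact: IH.
elim: (k : nat) => [|m Hm]; first by rewrite expg0.
by rewrite expgS; apply: SM => //; apply: sub_generated; exists 0.
Qed.

Lemma rotation_order : has_order (rotation p) p.
Proof.
split; first exact: prime_gt0.
  by rewrite rotationX pchar_Fp_0 // wreath1.
move=> m /andP[m0 mp]; rewrite rotationX -[RHS]wreath1.
by case/wreath_inj => /eqP; rewrite -(dvdn_pcharf (pchar_Fp pp)) gtnNdvd.
Qed.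

Lemma at_letter_order i g m : has_order g m -> has_order (at_letter i g) m.
Proof.
move=> [m0 gm min]; split=> //; first by rewrite -at_letterX gm at_letter1.
move=> j /min gj; rewrite -at_letterX -[X in _ <> X](at_letter1 i).
by move/at_letter_inj.
Qed.

Lemma rotations_order n h : rotations_at p n h -> has_order h p.
Proof.
elim: n h => [|n IH] h /=; first by move=> ->; exact: rotation_order.
by move=> [[i s] [_ /IH] Hs <-]; exact: at_letter_order.
Qed.

(** * Finite index of the rigid layer stabilisers *)

Lemma finitary_depth_finite n : finite_set (D n).
Proof.
(* A covering by a finite type passes through the induction: an element of depth [n.+1] is coded by
   a label and a finite function of codes. *)
suff [T [f fD]] : exists (T : finType) (f : T -> aut A), D n `<=` f @` setT.
  by apply: sub_finite_set fD _; apply: finite_image; exact: finite_finset.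
elim: n => [|n [T [f fD]]]; first by exists unit, (fun=> 1) => g ->; exists tt.
exists ('F_p * {ffun 'F_p -> T})%type,
  (fun c : 'F_p * {ffun 'F_p -> T} => wreath c.1 (fun x => f (c.2 x))).
move=> _ [k [w [-> Dw0]]]; have Dw x := cid2 (fD _ (Dw0 x)).
exists (k, [ffun x => s2val (Dw x)]) => //=; congr wreath; apply/funext => x /=.
by rewrite ffunE; case: (Dw x).
Qed.

Lemma at_letter_rigid_stab n (u : level A n) i g :
  rigid_stab (finitary p) u g ->
  rigid_level_stab (finitary p) n.+1 (at_letter i g).
Proof.
move=> [[Dg fixg] secg]; apply: sub_generated.
have Eu : vlen (@Defs.Cons A i (val u)) == n.+1 by rewrite /= vlen_level.
exists (@exist _ (fun t : vertex A => vlen t == n.+1) _ Eu) => //; split.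
  split=> [|[[|x t] lt] //]; first exact: at_letter_finitary.
  apply: val_inj; rewrite /= addr0; congr Defs.Cons.
  case: eqP => // _; have := fixg (exist _ t lt).
  by move/(congr1 val).
move=> [[|x t] lt] // neq; apply: autP => z.
(* Off the letter [i] the section is trivial by construction; below [i] it is a section of [g] at
   some [t] other than [u]. *)
rewrite /= /section_fun /=; case: eqP => [xi|_]; last first.
  by apply: (@vdrop_vcat (drop_seq 1 A) n t z); case/eqP: (lt).
have tu : @exist _ (fun t : vertex A => vlen t == n) t lt <> u.
  by move=> tu; apply: neq; apply: val_inj; rewrite /= xi -tu.
by have := congr1 (fun h : aut _ => h z) (secg _ tu).
Qed.

(** This yields finite index: each coset of the rigid layer stabiliser meets the finite set [D n].
    The representative [d] keeps the labels of the first [n] levels, and [g * d^-1] is then a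
    product of factors supported below single vertices. *)
Lemma rigid_level_stab_depth n g : finitary p g ->
  exists2 d, D n d & rigid_level_stab (finitary p) n (g * d^-1).
Proof.
elim: n g => [|n IH] g Dg.
  exists 1 => //; rewrite invg1 mulg1; apply: sub_generated.
  exists (exist _ (@Root A) (eqxx 0)) => //; split.
    split=> // u; apply: val_inj; rewrite /=.
    by rewrite (vlen0 (vlen_level u)) aut_root.
  by move=> u []; apply: val_inj; exact: vlen0 (vlen_level u).
(* Depth [N] is weakened to [N.+1] so that a wreath decomposition exists even for [N = 0]. *)
case: Dg => N _ /finitary_depthS[k [w [-> Dw]]].
have /choice[d Dd] x :
    exists d, D n d /\ rigid_level_stab (finitary p) n (w x * d^-1).
  have [d Dd Hd] := IH (w x) (ex_intro2 _ _ N I (Dw x)); by exists d.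
exists (wreath k d); first by apply: wreath_finitary_depth => x; case: (Dd x).
have -> : wreath k w * (wreath k d)^-1 = wreath 0%R (fun x => w x * (d x)^-1).
  rewrite wreathV wreathM subrr; congr wreath; apply/funext => x.
  by rewrite addrK.
apply: wreath0_subgroup => [|i]; first exact: generated_subgroup.
have [_] := Dd i; apply: at_letter_generated => [|s [u _ us]].
  exact: generated_subgroup.
exact: at_letter_rigid_stab us.
Qed.

Lemma finitary_branch : branch_group (finitary p).
Proof.
split; [exact: finitary_subgroup|exact: finitary_spherically_transitive|move=> n].
split.
  by apply: generated_min => [|g [u _ [[]]]]; first exact: finitary_subgroup.
have [_ HM HV] := generated_subgroup
  (\bigcup_(u : level A n) rigid_stab (finitary p) u).
apply: (@sub_finite_set _ _ (rcoset_of (rigid_level_stab (finitary p) n) @` D n)).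
  move=> _ [g Dg <-]; have [d Dd Hd] := rigid_level_stab_depth n Dg.
  exists d => //; apply/seteqP; split=> _ [h Hh <-].
    exists (h * (g * d^-1)^-1); first by apply: HM => //; exact: HV.
    by rewrite invgM invgK -!mulgA mulVg mulg1.
  by exists (h * (g * d^-1)); [exact: HM | rewrite -!mulgA mulVg mulg1].
by apply: finite_image; exact: finitary_depth_finite.
Qed.

(** * The Engel property *)

Definition shift_quotient w : 'F_p -> aut A := fun x => (w x)^-1 * w (x - 1)%R.

Lemma iter_shift_quotient1 m : iter m shift_quotient (fun=> 1) = fun=> 1.
Proof.
by elim: m => //= m ->; apply/funext => x; rewrite /shift_quotient mulVg.
Qed.

Lemma commg_rotation w :
  [~ wreath 0%R w, rotation p] = wreath 0%R (shift_quotient w).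
Proof.
rewrite /commg /conjg wreath0V wreathV !wreathM !add0r addNr.
congr wreath; apply/funext => x.
by rewrite /shift_quotient addr0 invg1 mul1g mulg1.
Qed.

(** On the root labels of the sections, [shift_quotient] is the difference operator, so [p]
    iterations make them vanish. Afterwards it acts separately for each second letter [y], on
    sections of smaller depth. *)
Lemma shift_quotient_nilpotent n w : (forall x, D n (w x)) ->
  exists m, iter m shift_quotient w = fun=> 1.
Proof.
elim: n w => [|n IH] w Dw; first by exists 0; apply/funext.
have /choice[k /choice[v wE]] := Dw.
have [v' w'E] : exists v' : 'F_p -> 'F_p -> aut A, forall x,
    iter p shift_quotient w x = wreath 0%R (v' x) /\ forall y, D n (v' x y).
  (* Only the labels are computed exactly; of the deeper sections it suffices that they stay of
     depth [n]. *)
  have H m : exists v' : 'F_p -> 'F_p -> aut A, forall x,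
      iter m shift_quotient w x =
        wreath (iter m (fun (f : 'F_p -> 'F_p) x => f (x - 1)%R - f x)%R k x)
          (v' x)
      /\ forall y, D n (v' x y).
    elim: m => [|m [v' v'E]]; first by exists v.
    set L := iter m _ k in v'E.
    exists (fun x y => (v' x (y - L x)%R)^-1 * v' (x - 1)%R (y - L x)%R) => x.
    rewrite !iterS -/L {1}/shift_quotient; have [-> Dx] := v'E x.
    have [-> Dx1] := v'E (x - 1)%R.
    rewrite wreathV wreathM addrC; split=> // y.
    by apply: finitary_depthM => //; exact: finitary_depthV.
  have [v' v'E] := H p; exists v' => x.
  by move: (v'E x); rewrite iter_difference_eq0.
have [|y|m mP] := @uniform_bound 'F_p
    (fun y m => iter m shift_quotient (v'^~ y) = fun=> 1).
- by move=> y m m' /subnK <- E; rewrite iterD E iter_shift_quotient1.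
- by apply: IH => x; case: (w'E x).
exists (m + p); rewrite iterD.
have -> : iter p shift_quotient w = fun x => wreath 0%R (v' x).
  by apply/funext => x; case: (w'E x).
have -> : iter m shift_quotient (fun x => wreath 0%R (v' x)) =
    fun x => wreath 0%R (fun y => iter m shift_quotient (v'^~ y) x).
  elim: (m) => //= j ->; apply/funext => x.
  by rewrite {1}/shift_quotient wreath0V wreath0M.
apply/funext => x; rewrite -wreath1; congr wreath; apply/funext => y.
by rewrite mP.
Qed.

(** The labels lie in an abelian group, so they cancel in the commutator, leaving a tuple of
    sections of no greater depth. *)
Lemma commg_wreath n k l w v : (forall x, D n (w x)) -> (forall x, D n (v x)) ->
  exists2 u, [~ wreath k w, wreath l v] = wreath 0%R u & forall x, D n (u x).
Proof.
move=> Dw Dv; rewrite /commg /conjg !wreathV !wreathM.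
rewrite [(k + l)%R]addrC addKr addNr; eexists; first reflexivity.
by move=> x; do ![exact: Dw | exact: Dv | apply: finitary_depthM
                 | apply: finitary_depthV].
Qed.

Lemma engel_comm_wreath0 w v m :
  engel_comm (wreath 0%R w) (wreath 0%R v) m =
  wreath 0%R (fun x => engel_comm (w x) (v x) m).
Proof. by rewrite /engel_comm; elim: m => //= m ->; rewrite wreath0R. Qed.

Lemma rotation_engel g : finitary p g ->
  exists m, engel_comm g (rotation p) m = 1.
Proof.
move=> [n _ /finitary_depthS[k [w [-> Dw]]]].
have [u E Du] := commg_wreath k 1%R Dw (fun=> finitary_depth1 n).
have [m mP] := shift_quotient_nilpotent Du.
(* One commutator clears the root label; the next [m] iterate [shift_quotient]. *)
exists m.+1; rewrite engel_commS E -wreath1 -mP.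
by rewrite /engel_comm; elim: (m) => //= j ->; rewrite commg_rotation.
Qed.

Lemma rotations_at_finitary n h : rotations_at p n h -> finitary p h.
Proof.
by move=> Sh; rewrite -generated_rotations; apply: sub_generated; exists n.
Qed.

Lemma rotations_engel n h : rotations_at p n h -> left_engel (finitary p) h.
Proof.
move=> Sh; split; first exact: rotations_at_finitary Sh.
elim: n h Sh => [|n IH] h /=; first by move=> -> g; exact: rotation_engel.
move=> [[i s] [_ Ss] <-] g [N _ /=].
have [M _ Ds] := rotations_at_finitary Ss.
move=> /(finitary_depth_le (leq_maxl N M))/finitary_depthS[k [w [-> Dw]]].
have [x|u E Du] := @commg_wreath (maxn N M) k 0%R w
    (fun x => if x == i then s else 1) Dw.
  case: ifP => _; last exact: finitary_depth1.
  exact: finitary_depth_le (leq_maxr N M) Ds.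
have [|x|m mP] := @uniform_bound 'F_p
    (fun x m => engel_comm (u x) (if x == i then s else 1) m = 1).
- by move=> x m m'; exact: engel_comm_le.
(* Off the letter [i], commutation with 1 ends after one step; at [i], the element [s] is a rotation
   one level higher, covered by the induction. *)
- case: ifP => _; last by exists 1%N; rewrite /engel_comm /= commg1.
  by apply: IH => //; exists (maxn N M).
exists m.+1; rewrite engel_commS E engel_comm_wreath0 -[RHS]wreath1.
by congr wreath; apply/funext.
Qed.

End Finitary.

Theorem theorem1p2 (p : nat) (hp : prime p) :
  exists X : nat -> finType, regular X /\
  exists G : set (aut X),
    [/\ branch_group G, is_p_group p G
      & exists2 S : set (aut X),
          forall h, S h -> left_engel G h /\ has_order h p
        & generated S = G].
Proof.
exists (Fp_alphabet p); split.
  by exists p => [|n]; [exact: prime_gt1 | exact: card_Fp].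
exists (finitary p); split; [exact: finitary_branch|exact: finitary_p_group|].
exists (\bigcup_n rotations_at p n); last exact: generated_rotations.
move=> h [n _ Sh].
by split; [exact: rotations_engel Sh | exact: rotations_order Sh].
Qed.
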